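(* Let $k\ge 3$, $b_k=2(k-2)$, and let $\overline{c}=(c_1,\dots,c_{b_k})$ be a 2-flat sequence of integers from $[0,2^{k-1}-1]$. For $i=1,\dots,6k-15$ let $f_i=Q^k_{((i-1)\bmod 3)+1}$ and let $f=f_{6k-15}\circ f_{6k-16}\circ\dots\circ f_1$. Then $f(\overline{c})$ is a flat sequence.
   Context: Let $h_i=2^{k-i-1}-1$ for $1\le i\le k-2$. For $\overline{c}=(c_1,\dots,c_{b_k})\in\mathbb{R}^{b_k}$ and $1\le i\le k-2$ define maps $\mathbb{R}^{b_k}\to\mathbb{R}^{b_k}$ (all entries not mentioned are unchanged): $cyc^k(\overline{c})$ has entry $1$ equal to $\max(c_1,c_{b_k}-1)$ and entry $b_k$ equal to $\min(c_1+1,c_{b_k})$; $dec^k_i(\overline{c})$ has entry $i$ equal to $\min(c_i,c_{b_k-i+1}+h_i)$ and entry $b_k-i+1$ equal to $\max(c_i-h_i,c_{b_k-i+1})$; $mov^k_i(\overline{c})$ has entry $t$ equal to $\min(c_t,c_{t+1})$ for $t\in\{i,b_k-i\}$ and entry $t$ equal to $\max(c_{t-1},c_t)$ for $t\in\{i+1,b_k-i+1\}$. Let $args(cyc^k)=\{1,b_k\}$, $args(dec^k_i)=\{i,b_k-i+1\}$, $args(mov^k_i)=\{i,i+1,b_k-i,b_k-i+1\}$. With $i$ ranging over $1,\dots,k-2$, let $Q^k_1=\{cyc^k\}\cup\{dec^k_i: i\equiv 2 \pmod 3\}\cup\{mov^k_i: i\equiv 0\pmod 3\}$, $Q^k_2=\{dec^k_i: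 i\equiv 1\}\cup\{mov^k_i: i\equiv 2\}$, $Q^k_3=\{dec^k_i: i\equiv 0\}\cup\{mov^k_i: i\equiv 1\}$ (mod 3). Within each $Q^k_r$ the sets $args(f)$ are pairwise disjoint, and $Q^k_r$ also denotes the map $\mathbb{R}^{b_k}\to\mathbb{R}^{b_k}$ given by $(Q^k_r(\overline{c}))_t=(f(\overline{c}))_t$ if $t\in args(f)$ for some $f\in Q^k_r$, and $(Q^k_r(\overline{c}))_t=c_t$ otherwise. A sequence $(c_1,\dots,c_{2m})$ is flat if $c_1\le c_2\le\dots\le c_{2m}\le c_1+1$, and 2-flat if both $(c_1,c_3,\dots,c_{2m-1})$ and $(c_2,c_4,\dots,c_{2m})$ are flat. *)

(* Defs.v *)
From HB Require Import structures.
From mathcomp Require Import all_boot all_order all_algebra.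
From mathcomp Require Import zify.
From mathcomp Require Import reals.

Set Implicit Arguments.
Unset Strict Implicit.
Unset Printing Implicit Defensive.

Import Order.TTheory GRing.Theory Num.Theory.
Local Open Scope ring_scope.

(* For x_1 <= ... <= x_n, [rcons s' (x_1 + 1)] appends the last link
   x_n <= x_1 + 1 of the chain. *)
Definition flat (R : realDomainType) (s : seq R) : bool :=
  if s is x :: s' then path <=%R x (rcons s' (x + 1)) else true.

(* Positions are 1-based throughout: [entry c t] is c_t for 1 <= t <= size c. *)
Definition entry (R : realDomainType) (c : seq R) (t : nat) : R := c`_t.-1.

Definition two_flat (R : realDomainType) (c : seq R) : bool :=
  flat [seq entry c t | t <- iota 1 (size c) & odd t] &&
  flat [seq entry c t | t <- iota 1 (size c) & ~~ odd t].

Definition width (k : nat) : nat := (2 * (k - 2))%N.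

(* Names of the maps cyc^k, dec^k_i and mov^k_i. *)
Inductive op := Cyc | Dec of nat | Mov of nat.

Definition op_code (f : op) : option (nat + nat) :=
  match f with Cyc => None | Dec i => Some (inl i) | Mov i => Some (inr i) end.
Definition op_decode (x : option (nat + nat)) : op :=
  match x with
  | None => Cyc | Some (inl i) => Dec i | Some (inr i) => Mov i
  end.
Lemma op_codeK : cancel op_code op_decode. Proof. by case. Qed.
HB.instance Definition _ := Equality.copy op (can_type op_codeK).

Definition args (k : nat) (f : op) : seq nat :=
  let b := width k in
  match f with
  | Cyc => [:: 1; b]
  | Dec i => [:: i; b - i + 1]
  | Mov i => [:: i; i + 1; b - i; b - i + 1]
  end%N.

(* The set Q^k_r, for r in {1, 2, 3}. *)
Definition Qset (k r : nat) : seq op :=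
  let decs a := [seq Dec i | i <- iota 1 (k - 2) & i == a %[mod 3]] in
  let movs a := [seq Mov i | i <- iota 1 (k - 2) & i == a %[mod 3]] in
  match r with
  | 1 => Cyc :: decs 2 ++ movs 0
  | 2 => decs 1 ++ movs 2
  | 3 => decs 0 ++ movs 1
  | _ => [::]
  end%N.

Section Maps.
Variables (R : realDomainType) (k : nat).
Local Notation b := (width k).
Implicit Types c : b.-tuple R.

(* The tuple (F 1, ..., F b). *)
Definition mk_seq (F : nat -> R) : b.-tuple R := [tuple F t.+1 | t < b].

Definition h (i : nat) : R := 2 ^+ (k - i - 1) - 1.

Definition apply_op (f : op) c : b.-tuple R :=
  let c_ t := entry c t in
  match f with
  | Cyc => mk_seq (fun t =>
      if t == 1%N then Num.max (c_ 1%N) (c_ b - 1)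
      else if t == b then Num.min (c_ 1%N + 1) (c_ b)
      else c_ t)
  | Dec i => mk_seq (fun t =>
      if t == i then Num.min (c_ i) (c_ (b - i + 1)%N + h i)
      else if t == (b - i + 1)%N then Num.max (c_ i - h i) (c_ (b - i + 1)%N)
      else c_ t)
  | Mov i => mk_seq (fun t =>
      if t \in [:: i; (b - i)%N] then Num.min (c_ t) (c_ (t + 1)%N)
      else if t \in [:: (i + 1)%N; (b - i + 1)%N]
        then Num.max (c_ (t - 1)%N) (c_ t)
      else c_ t)
  end.

(* By [args_disjoint] below, at most one f in Q^k_r has t among its args. *)
Definition Qmap (r : nat) c : b.-tuple R :=
  mk_seq (fun t =>
    if [seq f <- Qset k r | t \in args k f] is f :: _
    then entry (apply_op f c) t else entry c t).

Definition stage (i : nat) : b.-tuple R -> b.-tuple R :=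
  Qmap ((i - 1) %% 3 + 1)%N.

(* f_n \o ... \o f_1, with f_i = stage i. *)
Definition stages (n : nat) c : b.-tuple R :=
  foldl (fun d i => stage i d) c (iota 1 n).

End Maps.

Lemma args_disjoint (k r t : nat) (f g : op) : (3 <= k)%N ->
  f \in Qset k r -> g \in Qset k r -> t \in args k f -> t \in args k g -> f = g.
Proof.
move=> k3.
have wf e : e \in Qset k r -> match e with
    | Cyc => r = 1
    | Dec i => [/\ 0 < i, i <= k - 2, 0 < r & (i + r) %% 3 = 0]
    | Mov i => [/\ 0 < i, i <= k - 2, 0 < r & (i + r) %% 3 = 1]
    end%N.
  case: r => [|[|[|[|r]]]]; rewrite //= ?inE ?mem_cat.
  - case/or3P=> [/eqP-> //||] /mapP[i];
      rewrite mem_filter mem_iota => /andP[/eqP ia ib] ->; split; lia.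
  - case/orP=> /mapP[i];
      rewrite mem_filter mem_iota => /andP[/eqP ia ib] ->; split; lia.
  - case/orP=> /mapP[i];
      rewrite mem_filter mem_iota => /andP[/eqP ia ib] ->; split; lia.
move=> /wf + /wf; rewrite /args /width.
case: f => [|i|i]; case: g => [|j|j] //.
- by move=> r1 [j0 jk _ jr]; rewrite !inE => tf tg; exfalso; lia.
- by move=> r1 [j0 jk _ jr]; rewrite !inE => tf tg; exfalso; lia.
- by move=> [i0 ik _ ir] r1; rewrite !inE => tf tg; exfalso; lia.
- move=> [i0 ik _ ir] [j0 jk _ jr]; rewrite !inE => tf tg.
  by congr Dec; lia.
- by move=> [i0 ik _ ir] [j0 jk _ jr]; rewrite !inE => tf tg; exfalso; lia.
- by move=> [i0 ik _ ir] r1; rewrite !inE => tf tg; exfalso; lia.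
- by move=> [i0 ik _ ir] [j0 jk _ jr]; rewrite !inE => tf tg; exfalso; lia.
- move=> [i0 ik _ ir] [j0 jk _ jr]; rewrite !inE => tf tg.
  by congr Mov; lia.
Qed.

(* Main.v *)
Require Import Defs.
From mathcomp Require Import all_boot all_order all_algebra.
From mathcomp Require Import zify.
From mathcomp Require Import reals.

Import Order.TTheory GRing.Theory Num.Theory.
Local Open Scope ring_scope.

(* Put n = k - 2. Two-flatness makes all the sums c_i + c_(b-i+1) take values
   in some {s - 1, s}, so c is recovered by rounding from s and the numbers
   y_i = c_i - c_(b-i+1) + 1, 1 <= i <= n. On y the maps become a folding
   dynamics: cyc is y_1 |-> |y_1|, dec_i is y_i |-> min(y_i, 2^(n+2-i) - y_i),
   mov_i sorts (y_i, y_(i+1)), and mov_n is y_n |-> min(y_n, 2 - y_n). Negative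
   values travel left, one column per stage, until cyc reflects them; values
   above 1 travel right, one column per two stages, and are folded on the way so
   that they end in {0, 1}; then the zeros travel left to their final place.
   At each edge of the line at most one value can cross every three stages, and
   counting the values still waiting to cross bounds the three phases by
   3n - 2, 5n - 2 and 6n - 3 = 6k - 15 stages. *)

(** * The folding dynamics on columns *)

Definition height (n i : nat) : int := 2 ^+ (n.+1 - i).

(* Stage j acts on column i through exactly one map: dec_i, mov_i or mov_(i-1)
   (cyc playing the role of mov_0) when i + j = 0, 1 or 2 mod 3. *)
Definition step (n j : nat) (y : nat -> int) (i : nat) : int :=
  if ((i + j) %% 3 == 0)%N then Num.min (y i) (2 * height n i - y i)
  else if ((i + j) %% 3 == 1)%N then
    if i == n then Num.min (y n) (2 - y n) else Num.min (y i) (y i.+1)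
  else if i == 1%N then `|y 1%N| else Num.max (y i.-1) (y i).

Fixpoint orbit (n : nat) (y : nat -> int) (j : nat) : nat -> int :=
  if j is j'.+1 then step n j (orbit n y j') else y.

Lemma height_gt0 n i : 0 < height n i.
Proof. by rewrite exprn_gt0. Qed.

Lemma heightS n i : (i <= n)%N -> height n i = 2 * height n i.+1.
Proof. by move=> in_; rewrite /height subSn // subSS exprS. Qed.

Lemma height_last n : height n n = 2.
Proof. by rewrite /height subSnn. Qed.

Lemma step_dec n j y i : ((i + j) %% 3 = 0)%N ->
  step n j y i = Num.min (y i) (2 * height n i - y i).
Proof. by rewrite /step => ->. Qed.

Lemma step_min n j y i : ((i + j) %% 3 = 1)%N -> i != n ->
  step n j y i = Num.min (y i) (y i.+1).
Proof. by rewrite /step => -> /negbTE->. Qed.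

Lemma step_last n j y : ((n + j) %% 3 = 1)%N ->
  step n j y n = Num.min (y n) (2 - y n).
Proof. by rewrite /step => -> /=; rewrite eqxx. Qed.

Lemma step_max n j y i : ((i + j) %% 3 = 1)%N -> (0 < i)%N ->
  step n j y i.+1 = Num.max (y i) (y i.+1).
Proof.
case: i => // i ij _; rewrite /step.
by have -> : ((i.+2 + j) %% 3 = 2)%N by lia.
Qed.

Lemma step_first n j y : (j %% 3 = 1)%N -> step n j y 1 = `|y 1%N|.
Proof.
by move=> j1; rewrite /step; have -> : ((1 + j) %% 3 = 2)%N by lia.
Qed.

(* [3 <= i %% 3 + j] says that dec_i has acted by stage j; the bound is weaker
   between mov_(i-1) and the next dec_i. *)
Definition bounded (n j : nat) (y : nat -> int) : Prop :=
  forall i, (0 < i <= n)%N -> `|y i| <= height n 0 /\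
    ((3 <= i %% 3 + j)%N ->
      y i <= if ((i + j) %% 3 == 2)%N then 2 * height n i else height n i).

Lemma height_le n i : height n i <= height n 0.
Proof. by rewrite /height ler_eXn2l //; lia. Qed.

(** Column i can receive up to [height n i.-1], twice its own height, from mov_(i-1) or cyc; the
    next dec_i folds at [height n i] and restores the bound. *)
Lemma bounded_step n j y :
  bounded n j y -> bounded n j.+1 (step n j.+1 y).
Proof.
move=> yb i i_in; have [yi yi'] := yb i i_in.
have [H0 Hi] := (height_gt0 n i, height_le n i).
have [ij|ij] := eqVneq ((i + j.+1) %% 3)%N 0%N.
  by rewrite step_dec // ij /=; split; lia.
have [ij1|ij1] := eqVneq ((i + j.+1) %% 3)%N 1%N.
  have {}yi' : (3 <= i %% 3 + j.+1)%N -> y i <= height n i.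
    by case: eqP yi' => [|_ yi' ?]; [lia | apply: yi'; lia].
  rewrite ij1 /=; have [E|ni] := eqVneq i n.
    by subst i; rewrite step_last //; split; lia.
  have [|yi1 _] := yb i.+1; first by lia.
  by rewrite step_min //; split; lia.
have -> : ((i + j.+1) %% 3 == 2)%N by lia.
have {}yi' : (3 <= i %% 3 + j.+1)%N -> y i <= height n i.
  by case: eqP yi' => [|_ yi' ?]; [lia | apply: yi'; lia].
case: i => [|[|i]] // in i_in yi yi' H0 Hi ij ij1 *.
  by rewrite step_first; [have := @heightS n 0 isT; split; lia | lia].
have [|yi1 yi1'] := yb i.+1; first by lia.
rewrite step_max //; last by lia.
split=> [|i3]; first by lia.
rewrite -heightS; last by lia.
have := heightS n i.+1; case: eqP yi1'; lia.
Qed.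

(** * Counting on the two sides of an edge *)

(** Edge i lies between columns i and i.+1. The two counts will measure the values on either side
    that may still have to cross it. *)
Definition prefix_count (p : pred int) (y : nat -> int) (i : nat) : nat :=
  \sum_(1 <= t < i.+1) p (y t).
Definition suffix_count (n : nat) (q : pred int) (y : nat -> int) (i : nat)
    : nat :=
  \sum_(i.+1 <= t < n.+1) q (y t).

Lemma prefix_count0 p y : prefix_count p y 0 = 0%N.
Proof. by rewrite /prefix_count big_geq. Qed.

Lemma prefix_countS p y i :
  prefix_count p y i.+1 = (prefix_count p y i + p (y i.+1))%N.
Proof. by rewrite /prefix_count big_nat_recr. Qed.

Lemma suffix_count_last n q y : suffix_count n q y n = 0%N.
Proof. by rewrite /suffix_count big_geq. Qed.

Lemma suffix_countS n q y i : (i < n)%N ->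
  suffix_count n q y i = (q (y i.+1) + suffix_count n q y i.+1)%N.
Proof. by move=> lt; rewrite /suffix_count big_ltn. Qed.

Lemma prefix_count_le p y i : (prefix_count p y i <= i)%N.
Proof. by elim: i => [|i IH]; rewrite ?prefix_count0 // prefix_countS; lia. Qed.

Lemma suffix_count_le n q y i : (suffix_count n q y i <= n - i)%N.
Proof.
rewrite /suffix_count -subSS -[leqRHS]muln1 -sum_nat_const_nat.
by apply: leq_sum => t _; exact: leq_b1.
Qed.

(** Unless mov_i acts, nothing crosses edge i: every other mov_t permutes two columns on the same
    side. The induction peels off one column under a dec, two under a mov, and ends with cyc at
    column 1. *)
Lemma prefix_count_step n j (p : pred int) y i :
    (i <= n)%N -> ((i + j) %% 3 != 1)%N ->
    (forall t, (0 < t <= n)%N -> ((t + j) %% 3 = 0)%N ->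
       p (step n j y t) -> p (y t)) ->
    (p `|y 1%N| -> p (y 1%N)) ->
  (prefix_count p (step n j y) i <= prefix_count p y i)%N.
Proof.
move=> + + pdec pabs.
elim/ltn_ind: i => -[|i] IH; rewrite ?prefix_count0 // => lin ij.
have [i0|i0] := eqVneq ((i.+1 + j) %% 3)%N 0%N.
  have := IH i (ltnSn _) (ltnW lin); rewrite !prefix_countS.
  by have := pdec i.+1 lin i0; lia.
have {}ij : ((i + j) %% 3 = 1)%N by lia.
case: i => [|i] in IH lin ij i0 *.
  by rewrite !prefix_countS !prefix_count0 step_first ?add0n //; lia.
have := IH i (leqnSn _) (ltnW (ltnW lin)).
rewrite !prefix_countS step_min // ?step_max //; last by lia.
by rewrite minEle maxEle; case: ifP; lia.
Qed.

(** Mirror image of [prefix_count_step], by induction on n - i; mov_n at the right end takes the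
    place of cyc. *)
Lemma suffix_count_step n j (q : pred int) y i :
    (i <= n)%N -> ((i + j) %% 3 != 1)%N ->
    (forall t, (0 < t <= n)%N -> ((t + j) %% 3 = 0)%N ->
       q (step n j y t) -> q (y t)) ->
    (((n + j) %% 3 = 1)%N -> q (step n j y n) -> q (y n)) ->
  (suffix_count n q (step n j y) i <= suffix_count n q y i)%N.
Proof.
move=> lin + qdec qend.
rewrite -(subKn lin); move: (n - i)%N (leq_subr i n) => m {i lin}.
elim/ltn_ind: m => -[|m] IH lmn ij; first by rewrite subn0 !suffix_count_last.
have lt : (n - m.+1 < n)%N by lia.
rewrite !(suffix_countS _ _ _ _ lt).
have E : (n - m.+1).+1 = (n - m)%N by lia.
rewrite E.
have [i0|i0] := eqVneq ((n - m + j) %% 3)%N 0%N.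
  have := IH m (ltnSn _) (ltnW lmn); have := qdec (n - m)%N; lia.
have {}ij : ((n - m + j) %% 3 = 1)%N by lia.
case: m => [|m] in IH lmn lt ij i0 E *.
  by rewrite subn0 in ij *; rewrite !suffix_count_last; have := qend ij; lia.
have {}lt : (n - m.+1 < n)%N by lia.
have F : (n - m.+1).+1 = (n - m)%N by lia.
rewrite !(suffix_countS _ _ _ _ lt).
rewrite step_min ?(ltn_eqF lt) // step_max //; last by lia.
have := IH m; rewrite F minEle maxEle; case: ifP; lia.
Qed.

(** * Linear bounds on the crossing counts *)

Definition neg (x : int) : bool := x < 0.
Definition off (x : int) : bool := (x < 0) || (1 < x).
(** Used right of an edge in the last phase: it catches the zeros still moving left and the values
    that may yet be folded to zero. *)
Definition ne1 (x : int) : bool := x != 1.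

Lemma negE x : neg x = (x < 0). Proof. by []. Qed.
Lemma offE x : off x = (x < 0) || (1 < x). Proof. by []. Qed.
Lemma ne1E x : ne1 x = (x != 1). Proof. by []. Qed.

Section CountStep.
Variables (n j : nat) (y : nat -> int).
Hypotheses (j3 : (3 <= j)%N) (yb : bounded n j y).
Local Notation y' := (step n j.+1 y).

(** Just before dec_t acts, [bounded] gives y_t <= 2 * height n t, so the folded value is
    nonnegative. *)
Lemma neg_step_dec t : (0 < t <= n)%N -> ((t + j.+1) %% 3 = 0)%N ->
  neg (y' t) -> neg (y t).
Proof.
move=> t_in tj; rewrite /neg step_dec //.
have [_] := yb t t_in; have -> : ((t + j) %% 3)%N = 2%N by lia.
by rewrite /=; lia.
Qed.

Lemma last_le2 : (0 < n)%N -> ((n + j.+1) %% 3 = 1)%N -> y n <= 2.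
Proof.
move=> n0 nj; have [|_] := yb n; first by lia.
have -> : ((n + j) %% 3)%N = 0%N by lia.
by rewrite /= height_last; apply; lia.
Qed.

Lemma neg_suffix_step i : (i <= n)%N -> ((i + j.+1) %% 3 != 1)%N ->
  (suffix_count n neg y' i <= suffix_count n neg y i)%N.
Proof.
move=> in_ ij; case: (posnP n) => [n0|n0].
  by have -> : i = n; [lia | rewrite !suffix_count_last].
apply: suffix_count_step => // [t|nj]; first exact: neg_step_dec.
by rewrite /neg step_last //; have := last_le2 n0 nj; lia.
Qed.

Lemma ne1_suffix_step i : (i <= n)%N -> ((i + j.+1) %% 3 != 1)%N ->
  (suffix_count n ne1 y' i <= suffix_count n ne1 y i)%N.
Proof.
move=> in_ ij; apply: suffix_count_step => // [t t_in tj|nj]; rewrite /ne1.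
  by have := height_gt0 n t; rewrite step_dec //; lia.
by rewrite step_last //; lia.
Qed.

Lemma off_prefix_step i : (i <= n)%N -> ((i + j.+1) %% 3 != 1)%N ->
  (prefix_count off y' i <= prefix_count off y i)%N.
Proof.
move=> in_ ij; apply: prefix_count_step => // [t t_in tj|]; rewrite /off.
  by have := height_gt0 n t; rewrite step_dec //; lia.
by lia.
Qed.

(* The three linear bounds below drop by one at edge i exactly at the stages j
   with i + j = 1 mod 3, when mov_i acts; the wave of drops starts at edge 0 and
   moves right one edge per two stages for the first two, and starts at edge n
   and moves left one edge per stage for [sort_count_le]. *)
Definition neg_count_le (j : nat) (y : nat -> int) := forall i, (i <= n)%N ->
  let m := suffix_count n neg y i in m = 0%N \/ (j + i + 3 * m <= 3 * n)%N.

(** When mov_i acts and the new y_(i+1) is nonnegative, the bound at edge i+1 suffices. Otherwise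
    y_i and y_(i+1) were both negative, so edge i-1 counted one value more, and its bound
    suffices. *)
Lemma neg_count_step : neg_count_le j y -> neg_count_le j.+1 y'.
Proof.
move=> IH i; rewrite leq_eqVlt => /orP[/eqP->|in_] m.
  by left; exact: suffix_count_last.
have IHi := IH i (ltnW in_); rewrite /= in IHi.
(* If mov_i does not act, i + j is not a multiple of 3, so the old bound is strict and leaves room
   for one more stage. *)
have [ij|ij] := eqVneq ((i + j.+1) %% 3)%N 1%N; last first.
  by have := neg_suffix_step i (ltnW in_) ij; rewrite -/m; lia.
have IHi1 := IH i.+1 in_; rewrite /= in IHi1.
have ij1 : ((i.+1 + j.+1) %% 3 != 1)%N by lia.
have := neg_suffix_step i.+1 in_ ij1.
have mE := suffix_countS n neg y' i in_; rewrite -/m in mE.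
rewrite (suffix_countS n neg y i in_) in IHi.
case: i => [|i] in in_ m IHi ij IHi1 ij1 mE *.
  rewrite step_first in mE; last by lia.
  by move: mE IHi; rewrite !negE; lia.
have IHi0 := IH i (ltnW (ltnW in_)); rewrite /= in IHi0.
rewrite (suffix_countS n neg y i) ?(suffix_countS n neg y i.+1) //
  in IHi0; last exact: ltnW.
rewrite step_max // in mE.
by move: mE IHi IHi0; rewrite !negE; lia.
Qed.

(** A negative value right of edge i may return reflected, so it is counted with the values left of
    the edge outside {0, 1}. At edge 0 this is [neg_count_le]. *)
Definition off_count_le (j : nat) (y : nat -> int) := forall i, (i <= n)%N ->
  let m := (prefix_count off y i + suffix_count n neg y i)%N in
  m = 0%N \/ (j + 3 * m <= 3 * n + 2 * i)%N.

(** When mov_i acts, edge i-1 already counted at least as many values, unless y_i and y_(i+1) both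
    exceed 1; then edge i+1 counted one more, and its bound suffices. For mov_n, y_n <= 2 leaves
    only the first case. *)
Lemma off_count_step :
  neg_count_le j y -> off_count_le j y -> off_count_le j.+1 y'.
Proof.
move=> IHneg IH [|i] in_ m.
  have := neg_count_step IHneg 0%N in_.
  by rewrite /m prefix_count0 /=; lia.
have IHi := IH i.+1 in_; rewrite /= in IHi.
have [ij|ij] := eqVneq ((i.+1 + j.+1) %% 3)%N 1%N; last first.
  have := off_prefix_step i.+1 in_ ij.
  by have := neg_suffix_step i.+1 in_ ij; rewrite /m; lia.
have IHi0 := IH i (ltnW in_); rewrite /= in IHi0.
have ij0 : ((i + j.+1) %% 3 != 1)%N by lia.
have := off_prefix_step i (ltnW in_) ij0.
have mE : m = (prefix_count off y' i + off (y' i.+1)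
  + suffix_count n neg y' i.+1)%N by rewrite -prefix_countS.
rewrite prefix_countS in IHi.
rewrite (suffix_countS n neg y i) // in IHi0.
have [E|ni] := eqVneq i.+1 n.
  have yE : y' i.+1 = Num.min (y i.+1) (2 - y i.+1).
    by rewrite E step_last // -E.
  have y2 : y i.+1 <= 2 by rewrite E; apply: last_le2; rewrite -E.
  have last0 z : suffix_count n neg z i.+1 = 0%N by rewrite E suffix_count_last.
  by move: mE IHi IHi0; rewrite !last0 yE !offE !negE; lia.
have {}in_ : (i.+1 < n)%N by lia.
have IHi1 := IH i.+2 in_; rewrite /= in IHi1.
rewrite !prefix_countS in IHi1.
have ij1 : ((i.+2 + j.+1) %% 3 != 1)%N by lia.
have := neg_suffix_step i.+2 in_ ij1.
move: mE IHi IHi0 IHi1; rewrite !(suffix_countS n neg _ i.+1) //.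
by rewrite step_min // step_max // !offE !negE; lia.
Qed.

(** The first alternative is needed because zeros right of edge i stop moving left once columns 1 to
    i are filled with zeros. *)
Definition sort_count_le (j : nat) (y : nat -> int) := forall i, (i <= n)%N ->
  let m := (prefix_count off y i + suffix_count n ne1 y i)%N in
  (forall t, (0 < t <= i)%N -> y t = 0) \/
  m = 0%N \/ (i + j + 3 * m <= 6 * n)%N.

(** Only mov_i brings in a column from outside the prefix, and its minimum with a nonnegative value
    is still 0. *)
Lemma zero_prefix_step i : (i < n)%N -> 0 <= y i.+1 ->
  (forall t, (0 < t <= i)%N -> y t = 0) ->
  forall t, (0 < t <= i)%N -> y' t = 0.
Proof.
move=> in_ yi y0 t t_in; have yt := y0 t t_in.
rewrite /step; case: ifP => _; first by have := height_gt0 n t; lia.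
case: ifP => _.
  rewrite ltn_eqF; last by lia.
  have [E|ti] := eqVneq t i; first by rewrite -E in yi *; lia.
  by rewrite (y0 t.+1); lia.
by case: eqP => [t1|t1]; [rewrite -t1; lia | rewrite (y0 t.-1); lia].
Qed.


Lemma sort_count_step : neg_count_le j y -> off_count_le j y ->
  sort_count_le j y -> sort_count_le j.+1 y'.
Proof.
move=> IHneg IHoff IH [|i]; first by left=> t; lia.
rewrite leq_eqVlt => /orP[/eqP E|in_] m.
  (* At edge n the suffix counts vanish, and the bound 3n + 2n plus the edge number n gives 6n. *)
  right; have := off_count_step IHneg IHoff n (leqnn n).
  by rewrite /m E !suffix_count_last /=; lia.
(* Since m <= n, the bound is automatic up to this time. *)
have [small|big] := leqP (i.+1 + j.+1) (3 * n).
  have := prefix_count_le off y' i.+1; have := suffix_count_le n ne1 y' i.+1.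
  by right; right; rewrite /m; lia.
(* After that time a single negative value right of edge i would violate [IHneg]. *)
have ynneg : 0 <= y i.+1 /\ 0 <= y i.+2.
  have := IHneg i; rewrite /= (suffix_countS n neg y i); last exact: ltnW.
  rewrite (suffix_countS n neg y i.+1) //.
  by rewrite !negE; lia.
have [z|nz] : (forall t, (0 < t <= i.+1)%N -> y t = 0) \/
              ~ (forall t, (0 < t <= i.+1)%N -> y t = 0).
  case: (boolP (all (fun t => y t == 0) (iota 1 i.+1))) => [/allP|/allPn] H.
    by left=> t t_in; apply/eqP/H; rewrite mem_iota; lia.
  right=> H'; case: H => t; rewrite mem_iota => t_in; rewrite H' //; lia.
  by left; apply: zero_prefix_step => //; lia.
right.
case: (IH i.+1 (ltnW in_)) => [/nz[]|/= IHi].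
have [ij|ij] := eqVneq ((i.+1 + j.+1) %% 3)%N 1%N; last first.
  have := off_prefix_step i.+1 (ltnW in_) ij.
  by have := ne1_suffix_step i.+1 (ltnW in_) ij; rewrite /m; lia.
have ij0 : ((i + j.+1) %% 3 != 1)%N by lia.
have ij1 : ((i.+2 + j.+1) %% 3 != 1)%N by lia.
have := off_prefix_step i (ltnW (ltnW in_)) ij0.
have := ne1_suffix_step i.+2 in_ ij1.
have mE : m = (prefix_count off y' i + off (y' i.+1)
    + ne1 (y' i.+2) + suffix_count n ne1 y' i.+2)%N.
  by rewrite -prefix_countS -addnA -suffix_countS.
rewrite step_min // ?step_max // in mE; last by lia.
rewrite prefix_countS suffix_countS // in IHi.
(* If y_(i+2) is not 0, edge i+2 already had the new count. If only y_(i+2) is 0, this zero crosses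
   edge i+1 and the count drops. If both are 0, edge i counted one value more. *)
have [y2|y2] := eqVneq (y i.+2) 0; last first.
  case: (IH i.+2 in_) => [H|/= IHi2]; first by case/eqP: y2; apply: H; lia.
  rewrite !prefix_countS in IHi2.
  by move: mE IHi IHi2; rewrite !offE !ne1E; lia.
have [y1|y1] := eqVneq (y i.+1) 0; last first.
  by move: mE IHi; rewrite !offE !ne1E; lia.
case: (IH i (ltnW (ltnW in_))) => [H|/= IHi0].
  case: nz => t t_in; have [->//|ti] := eqVneq t i.+1; apply: H; lia.
rewrite (suffix_countS n ne1 y i) ?(suffix_countS n ne1 y i.+1) //
  in IHi0; last exact: ltnW.
by move: mE IHi IHi0; rewrite !offE !ne1E y1 y2; lia.
Qed.

End CountStep.

(** * The orbit from stage 3 to stage 6n - 3 *)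

Section Orbit.
Variables (n : nat) (y : nat -> int).
Hypothesis y_le : forall i, (0 < i <= n)%N -> `|y i| <= height n 0.

Lemma bounded_orbit j : bounded n j (orbit n y j).
Proof.
elim: j => [|j IH] /=; last exact: bounded_step.
by move=> i i_in; split; [exact: y_le | lia].
Qed.

(** Cyc makes column 1 nonnegative, dec_1 keeps it so because 2 * height n 1 = height n 0, and mov_1
    takes the maximum into column 2. The counts near the left end at stage 3 need this one
    nonnegative column. *)
Lemma orbit3_ge0 : (1 < n)%N -> 0 <= orbit n y 3 2.
Proof.
move=> n1; rewrite /= step_max // le_max; apply/orP; left.
rewrite step_dec // step_first // -heightS //.
by have := y_le 1; lia.
Qed.

(* Only after stage 3 has every dec_i acted; from then on no dec_i creates a
   negative value, so the counts are started there. *)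
Lemma neg_count3 : (1 < n)%N -> neg_count_le n 3 (orbit n y 3).
Proof.
move=> n1; move: (orbit n y 3) (orbit3_ge0 n1) => z z2.
case=> [|[|i]] in_ m; last first.
- by have := suffix_count_le n neg z i.+2; rewrite -/m; lia.
- rewrite /m suffix_countS // negE ltNge z2 //=.
  by have := suffix_count_le n neg z 2; lia.
rewrite /m (suffix_countS _ _ _ 0) ?(suffix_countS _ _ _ 1) //;
  last exact: ltnW.
rewrite (negE (_ 2%N)) ltNge z2 //=.
by have := suffix_count_le n neg z 2; lia.
Qed.

Lemma off_count3 : (1 < n)%N -> off_count_le n 3 (orbit n y 3).
Proof.
move=> n1; move: (orbit n y 3) (orbit3_ge0 n1) (neg_count3 n1) => z z2 zneg.
move=> [|i] in_ m.
  by have := zneg 0%N in_; rewrite /m prefix_count0 /=; lia.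
have := prefix_count_le off z i.+1.
have := suffix_count_le n neg z i.+1.
case: i => [|i] in in_ m *; last by rewrite /m; lia.
rewrite /m (suffix_countS _ _ _ 1) // negE ltNge z2 //=.
by have := suffix_count_le n neg z 2; lia.
Qed.

Lemma sort_count3 : (1 < n)%N -> sort_count_le n 3 (orbit n y 3).
Proof.
move=> n1 i in_ m; right; right.
have := prefix_count_le off (orbit n y 3) i.
by have := suffix_count_le n ne1 (orbit n y 3) i; rewrite /m; lia.
Qed.

Lemma count_orbit j : (1 < n)%N -> (3 <= j)%N ->
  [/\ neg_count_le n j (orbit n y j), off_count_le n j (orbit n y j)
    & sort_count_le n j (orbit n y j)].
Proof.
move=> n1; elim: j => // j IH; rewrite leq_eqVlt => /orP[/eqP<-|j3].
  by split; [exact: neg_count3 | exact: off_count3 | exact: sort_count3].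
have [IHneg IHoff IHsort] := IH j3.
have yb := bounded_orbit j.
split; [exact: neg_count_step | exact: off_count_step | exact: sort_count_step].
Qed.

Lemma orbit_sorted : let z := orbit n y (6 * n - 3) in
  (forall i, (0 < i <= n)%N -> 0 <= z i <= 1) /\
  (forall i, (0 < i < n)%N -> z i <= z i.+1).
Proof.
(* For n = 1 there is no column 2, and the three stages are evaluated directly. *)
have [n0|n1] := leqP n 1.
  case: n n0 y_le => [|[|//]] _ yB; first by split=> i; lia.
  have yB1 : `|y 1| <= 4 by exact: yB.
  split=> [i /andP[i0 i1]|i]; last by lia.
  have -> : i = 1%N by lia.
  by rewrite (_ : 6 * 1 - 3 = 3)%N // /= step_last // step_dec // step_first //
    height_last; lia.
have j3 : (3 <= 6 * n - 3)%N by lia.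
have [_ _ Hs] := count_orbit _ n1 j3.
move: Hs; set z := orbit _ _ _ => Hs.
have z01 i : (0 < i <= n)%N -> 0 <= z i <= 1.
  move=> i_in; case: (Hs n (leqnn n)) => [->//|/= Hn].
  have {Hn} : prefix_count off z n = 0%N.
    by move: Hn; rewrite suffix_count_last; lia.
  have : (0 < i <= n)%N -> (off (z i) <= prefix_count off z n)%N.
    move: {i_in} n => m; elim: m => [|m IH]; first by lia.
    rewrite prefix_countS; have [->|ne] := eqVneq i m.+1; lia.
  by move=> /(_ i_in) + H0; rewrite H0 offE; lia.
split=> // i i_in; have [zi zi1] : 0 <= z i <= 1 /\ 0 <= z i.+1 <= 1.
  by split; apply: z01; lia.
(* At stage 6n - 3 the bound reads i + 3m <= 3, so m = 0: either columns 1 to i are all 0, or column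
   i+1 is 1. *)
case: (Hs i) => [|H|/= Hi]; first by lia.
  by rewrite H; lia.
have : (suffix_count n ne1 z i = 0)%N by lia.
rewrite suffix_countS ?ne1E; lia.
Qed.

End Orbit.

(** * Simulation of the maps on tuples by the dynamics *)

Section Simulation.
Variables (R : realType) (k : nat).
Hypothesis k3 : (3 <= k)%N.
Local Notation b := (width k).

Lemma entry_mk_seq (F : nat -> R) t : (0 < t <= b)%N ->
  entry (mk_seq k F) t = F t.
Proof.
move=> t_in; have tb : (t.-1 < b)%N by lia.
by rewrite /entry -(tnth_nth 0 _ (Ordinal tb)) tnth_mktuple /=; congr F; lia.
Qed.

Lemma entry_Qmap r (c : b.-tuple R) f t :
    f \in Qset k r -> t \in args k f -> (0 < t <= b)%N ->
  entry (Qmap r c) t = entry (apply_op f c) t.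
Proof.
move=> fQ tf t_in; rewrite entry_mk_seq //.
have : f \in [seq g <- Qset k r | t \in args k g] by rewrite mem_filter tf.
case E: [seq g <- Qset k r | t \in args k g] => [|g s] // _.
have : g \in [seq g <- Qset k r | t \in args k g] by rewrite E mem_head.
by rewrite mem_filter => /andP[tg gQ]; rewrite (args_disjoint k3 gQ fQ tg tf).
Qed.

Lemma Dec_in_Qset j i : (0 < i <= k - 2)%N -> ((i + j.+1) %% 3 = 0)%N ->
  Dec i \in Qset k ((j.+1 - 1) %% 3 + 1).
Proof.
move=> i_in ij; have : (j %% 3 < 3)%N by rewrite ltn_mod.
rewrite subn1 /=; case E: (j %% 3)%N => [|[|[|//]]] _ /=.
- by rewrite inE mem_cat map_f ?orbT // mem_filter mem_iota; lia.
- by rewrite mem_cat map_f // mem_filter mem_iota; lia.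
- by rewrite mem_cat map_f // mem_filter mem_iota; lia.
Qed.

Lemma Mov_in_Qset j i : (0 < i <= k - 2)%N -> ((i + j.+1) %% 3 = 1)%N ->
  Mov i \in Qset k ((j.+1 - 1) %% 3 + 1).
Proof.
move=> i_in ij; have : (j %% 3 < 3)%N by rewrite ltn_mod.
rewrite subn1 /=; case E: (j %% 3)%N => [|[|[|//]]] _ /=.
- by rewrite inE mem_cat (map_f Mov) ?orbT // mem_filter mem_iota; lia.
- by rewrite mem_cat (map_f Mov) ?orbT // mem_filter mem_iota; lia.
- by rewrite mem_cat (map_f Mov) ?orbT // mem_filter mem_iota; lia.
Qed.

Lemma Cyc_in_Qset j : (j.+1 %% 3 = 1)%N ->
  Cyc \in Qset k ((j.+1 - 1) %% 3 + 1).
Proof. by move=> j1; have -> : ((j.+1 - 1) %% 3 = 0)%N by lia. Qed.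

Lemma min_intr (u v : int) : Num.min u%:~R v%:~R = (Num.min u v)%:~R :> R.
Proof. by rewrite !minEle ler_int; case: ifP. Qed.

Lemma max_intr (u v : int) : Num.max u%:~R v%:~R = (Num.max u v)%:~R :> R.
Proof. by rewrite !maxEle ler_int; case: ifP. Qed.

(* That is, c is the entrywise floor of the real sequence with entries
   (s + 1/2 + (y_i - 1)) / 2 and (s + 1/2 - (y_i - 1)) / 2 at i and b - i + 1;
   the floor commutes with min, max and integer shifts, hence with every map. *)
Definition represents (s : int) (y : nat -> int) (c : b.-tuple R) : Prop :=
  forall i, (0 < i <= k - 2)%N ->
    entry c i = ((s + y i - 1) %/ 2)%Z%:~R /\
    entry c (b - i + 1) = ((s + 1 - y i) %/ 2)%Z%:~R.

Lemma h_height i : (0 < i <= k - 2)%N -> h R k i = (height (k - 2) i - 1)%:~R.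
Proof.
move=> i_in; rewrite /h /height (_ : (k - 2).+1 - i = k - i - 1)%N; last by lia.
by rewrite rmorphB rmorphXn.
Qed.

(** Exchanging entries i and b - i + 1, with the shifts of cyc, dec_i or mov_n, replaces y_i by
    -y_i, 2 * height n i - y_i or 2 - y_i; the other mov_i compare y_i with y_(i+1). *)
Lemma represents_stage s y c j : represents s y c ->
  represents s (step (k - 2) j.+1 y) (stage j.+1 c).
Proof.
move=> yc i i_in; have [ci cmi] := yc i i_in; rewrite /stage.
have bE : b = (2 * (k - 2))%N by [].
have [ij|ij0] := eqVneq ((i + j.+1) %% 3)%N 0%N.
  have fQ := Dec_in_Qset j i i_in ij.
  rewrite !(entry_Qmap _ _ _ _ fQ) ?inE ?eqxx ?orbT //; try lia.
  rewrite !entry_mk_seq ?eqxx; try lia.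
  rewrite (_ : (b - i + 1 == i)%N = false); last by lia.
  rewrite ci cmi h_height // -!rmorphD -rmorphB max_intr min_intr step_dec //.
  by split; congr _%:~R; lia.
have [ij|ij1] := eqVneq ((i + j.+1) %% 3)%N 1%N.
  have fQ := Mov_in_Qset j i i_in ij.
  rewrite !(entry_Qmap _ _ _ _ fQ) ?inE ?eqxx ?orbT //; try lia.
  rewrite !entry_mk_seq ?inE ?eqxx ?orbT /=; try lia.
  rewrite (_ : (b - i + 1 == i)%N = false); last by lia.
  rewrite (_ : (b - i + 1 == b - i)%N = false) /=; last by lia.
  rewrite addnK cmi ci.
  (* For i = k - 2 the two pairs of mov_i coincide: it sorts the two middle entries. *)
  have [E|ni] := eqVneq i (k - 2)%N.
    have e1 : (b - i = i)%N by lia.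
    rewrite e1 in cmi *.
    rewrite cmi ci max_intr min_intr E step_last -?E //.
    by split; congr _%:~R; lia.
  have [ci1 cmi1] : entry c (i + 1) = ((s + y i.+1 - 1) %/ 2)%Z%:~R /\
      entry c (b - i) = ((s + 1 - y i.+1) %/ 2)%Z%:~R.
    have := yc i.+1; rewrite (_ : b - i.+1 + 1 = b - i)%N; last by lia.
    by rewrite addn1; apply; lia.
  rewrite ci1 cmi1 max_intr min_intr step_min //.
  by split; congr _%:~R; lia.
case: i => [|[|i]] // in i_in ci cmi ij0 ij1 *.
  have j1 : (j.+1 %% 3 = 1)%N by lia.
  have fQ := Cyc_in_Qset j j1.
  have e1 : (b - 1 + 1 = b)%N by lia.
  rewrite e1 in cmi *.
  rewrite !(entry_Qmap _ _ _ _ fQ) ?inE ?eqxx ?orbT //; try lia.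
  rewrite !entry_mk_seq ?inE ?eqxx ?orbT /=; try lia.
  rewrite (_ : (b == 1)%N = false); last by lia.
  rewrite ci cmi -[1 in X in X = _ /\ _]/(1%:~R).
  rewrite -[X in _ /\ Num.min (_ + X) _ = _]/(1%:~R).
  rewrite -rmorphD -rmorphB max_intr min_intr step_first //.
  by split; congr _%:~R; lia.
have ij : ((i.+1 + j.+1) %% 3 = 1)%N by lia.
have i_in' : (0 < i.+1 <= k - 2)%N by lia.
have fQ := Mov_in_Qset j i.+1 i_in' ij.
have e1 : (b - i.+2 + 1 = b - i.+1)%N by lia.
rewrite e1 in cmi *.
rewrite !(entry_Qmap _ _ _ _ fQ) ?inE ?eqxx ?orbT ?addn1 ?eqxx ?orbT //;
  try lia.
rewrite !entry_mk_seq ?inE ?eqxx ?orbT ?addn1 ?eqxx /=; try lia.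
rewrite (_ : (i.+2 == i.+1)%N = false); last by lia.
rewrite (_ : (i.+2 == b - i.+1)%N = false) /=; last by lia.
have [ci1 cmi1] := yc i.+1 i_in'; rewrite addn1 in cmi1.
rewrite subn1 /= ci cmi ci1 cmi1 max_intr min_intr step_max //.
by split; congr _%:~R; lia.
Qed.

Lemma represents_stages s y c j : represents s y c ->
  represents s (orbit (k - 2) y j) (stages j c).
Proof.
move=> yc; elim: j => // j IH.
have -> : stages j.+1 c = stage j.+1 (stages j c).
  by rewrite /stages -(addn1 j) iotaD foldl_cat (addnC 1%N).
exact: represents_stage.
Qed.

End Simulation.

(** * Flat sequences entry by entry *)

Lemma flat_entries (R : realDomainType) (c : seq R) :
    (forall t, (0 < t < size c)%N -> entry c t <= entry c t.+1) ->
    entry c (size c) <= entry c 1 + 1 ->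
  flat c.
Proof.
case: c => // x s step_le wrap; apply/(pathP 0) => i; rewrite size_rcons ltnS.
move=> i_le; rewrite -rcons_cons !nth_rcons /= ltnS i_le.
move: i_le; rewrite leq_eqVlt => /orP[/eqP->|i_lt].
  by rewrite ltnn eqxx; exact: wrap.
by rewrite i_lt; apply: (step_le i.+1).
Qed.

Lemma flat_le_add1 (R : realDomainType) (c : seq R) : flat c ->
  {in c &, forall u v, u <= v + 1}.
Proof.
case: c => // x s; rewrite /flat (path_sortedE le_trans).
rewrite all_rcons => /andP[/andP[_ /allP xs]].
rewrite (sorted_pairwise le_trans) pairwise_rcons => /andP[/allP sx _].
move=> u v u_in v_in.
have ux : u <= x + 1.
  by move: u_in; rewrite inE => /orP[/eqP->|/sx//]; rewrite lerDl ler01.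
apply: le_trans ux _; rewrite lerD2r.
by move: v_in; rewrite inE => /orP[/eqP->|/xs].
Qed.

Lemma flat_filter_le (R : realDomainType) (F : nat -> R) (P : pred nat) m :
    flat [seq F t | t <- iota 1 m & P t] ->
  forall t u, P t -> P u -> (0 < t < u)%N -> (u <= m)%N -> F t <= F u.
Proof.
set l := [seq t <- _ | _] => fl t u Pt Pu tu um.
have tl : t \in l by rewrite mem_filter Pt mem_iota; lia.
have ul : u \in l by rewrite mem_filter Pu mem_iota; lia.
have lsort : sorted ltn l := sorted_filter ltn_trans _ (iota_ltn_sorted 1 m).
have Fl : sorted (relpre F <=%R) l.
  rewrite -sorted_map; case: (map F l) fl => //= x s.
  by rewrite rcons_path => /andP[].
have index_lt : (index t l < index u l)%N.
  rewrite ltnNge leq_eqVlt negb_or; apply/andP; split.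
    by apply/eqP => /index_inj E; move: tu; rewrite E ?ltnn ?andbF.
  apply/negP => /(sorted_ltn_index ltn_trans lsort _ _ ul tl) /=; lia.
by apply: (sorted_ltn_index _ Fl) => // a b' c'; exact: le_trans.
Qed.

(** * Mirror sums of a two-flat sequence *)

Section Initial.
Variables (k : nat) (z : nat -> int).
Local Notation b := (width k).
Hypothesis k3 : (3 <= k)%N.
Hypothesis z_le : forall t u, odd t = odd u -> (0 < t < u)%N -> (u <= b)%N ->
  z t <= z u.
Hypothesis z_le1 : forall t u, odd t = odd u -> (0 < t <= b)%N ->
  (0 < u <= b)%N -> z t <= z u + 1.

(** The width is even, so i and b - i + 1 have opposite parity. Terms of equal parity are paired:
    one pair is ordered by monotonicity, the other loses at most 1 by flatness. *)
Lemma mirror_sum_le1 i i' : (0 < i <= k - 2)%N -> (0 < i' <= k - 2)%N ->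
  z i + z (b - i + 1)%N <= z i' + z (b - i' + 1)%N + 1.
Proof.
move=> i_in i'_in; have bE : b = (2 * (k - 2))%N by [].
have [pe|pe] := eqVneq (odd i) (odd i').
  have [->|] := eqVneq i i'; first by lia.
  rewrite neq_ltn => /orP[lt|lt].
    have := z_le i i' pe; have := z_le1 (b - i + 1) (b - i' + 1); lia.
  have := z_le (b - i + 1) (b - i' + 1); have := z_le1 i i' pe; lia.
have := z_le i (b - i' + 1); have := z_le1 (b - i + 1) i'; lia.
Qed.

Lemma mirror_sum_two_values : exists s : int, forall i, (0 < i <= k - 2)%N ->
  z i + z (b - i + 1)%N = s \/ z i + z (b - i + 1)%N = s - 1.
Proof.
pose S i := z i + z (b - i + 1)%N.
have one_in : (0 < 1 <= k - 2)%N by lia.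
(* All sums are within 1 of each other, so s is S 1 + 1 if that value occurs, and S 1 otherwise. *)
have [/hasP[i]|/hasPn H] :=
    boolP (has (fun i => S i == S 1%N + 1) (iota 1 (k - 2))).
  rewrite mem_iota => i_in /eqP Si; exists (S 1%N + 1) => i' i'_in.
  have := mirror_sum_le1 i i'; have := mirror_sum_le1 i' 1.
  by rewrite -!/(S _); lia.
exists (S 1%N) => i i_in.
have := mirror_sum_le1 1 i; have := mirror_sum_le1 i 1; rewrite -!/(S _).
by have := H i; rewrite mem_iota; lia.
Qed.

End Initial.

(** * Back to the tuple and conclusion *)

(** Monotonicity of y orders each half of c, y_n <= 1 orders the two middle entries, and y_1 >= 0
    gives the wrap-around inequality. *)
Lemma represents_flat (R : realType) (k : nat) (s : int) y
    (c : (width k).-tuple R) :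
    (3 <= k)%N -> represents R k s y c ->
    (forall i, (0 < i <= k - 2)%N -> 0 <= y i <= 1) ->
    (forall i, (0 < i < k - 2)%N -> y i <= y i.+1) ->
  flat c.
Proof.
move=> k3 yc y01 y_le; have bE : width k = (2 * (k - 2))%N by [].
have [c1 cb] := yc 1%N ltac:(lia); have y1 := y01 1%N ltac:(lia).
rewrite (_ : width k - 1 + 1 = width k)%N in cb; last by lia.
apply: flat_entries; rewrite size_tuple; last first.
  by rewrite c1 cb -[1 in X in _ <= X]/(1%:~R) -rmorphD ler_int; lia.
move=> t t_in; have [t_lt|] := ltnP t (k - 2).
  have [ct _] := yc t ltac:(lia); have [ct1 _] := yc t.+1 ltac:(lia).
  by rewrite ct ct1 ler_int; have := y_le t; lia.
rewrite leq_eqVlt => /orP[/eqP E|t_gt].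
  have [ct ct1] := yc t ltac:(lia).
  rewrite (_ : width k - t + 1 = t.+1)%N in ct1; last by lia.
  by rewrite ct ct1 ler_int; have := y01 t; lia.
have [_ ct] := yc (width k - t + 1)%N ltac:(lia).
have [_ ct1] := yc (width k - t)%N ltac:(lia).
rewrite (_ : width k - (width k - t + 1) + 1 = t)%N in ct; last by lia.
rewrite (_ : width k - (width k - t) + 1 = t.+1)%N in ct1; last by lia.
rewrite ct ct1 ler_int; have := y_le (width k - t)%N.
by rewrite -[(width k - t).+1]addn1; lia.
Qed.

Theorem theorem2 (R : realType) (k : nat) (c : (width k).-tuple R)
    (hk : (3 <= k)%N)
    (c_int : forall x, x \in c -> x \is a Num.int)
    (c_range : forall x, x \in c -> 0 <= x <= 2 ^+ (k - 1) - 1)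
    (c_flat : two_flat c) :
  flat (stages (6 * k - 15) c).
Proof.
have bE : width k = (2 * (k - 2))%N by [].
pose z t := Num.floor (entry c t).
have c_mem t : (0 < t <= width k)%N -> entry c t \in c.
  by move=> t_in; rewrite mem_nth // size_tuple; lia.
have cz t : (0 < t <= width k)%N -> entry c t = (z t)%:~R.
  by move=> t_in; rewrite /z floorK // c_int // c_mem.
have z_range t : (0 < t <= width k)%N -> 0 <= z t < height (k - 2) 0.
  move=> t_in; have := c_range _ (c_mem t t_in).
  rewrite cz // /height (_ : (k - 2).+1 - 0 = k - 1)%N; last by lia.
  have -> : 2 ^+ (k - 1) - 1 = (2 ^+ (k - 1) - 1)%:~R :> R.
    by rewrite rmorphB rmorphXn.
  by rewrite ler0z ler_int; lia.
move: c_flat; rewrite /two_flat size_tuple => /andP[odd_flat even_flat].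
have z_le t u : odd t = odd u -> (0 < t < u)%N -> (u <= width k)%N ->
    z t <= z u.
  move=> tu t_lt u_le; rewrite -(ler_int R) -!cz; [|lia|lia].
  by case: (boolP (odd t)) => t_odd;
    [apply: (flat_filter_le _ _ _ _ odd_flat)
    | apply: (flat_filter_le _ _ _ _ even_flat)]; rewrite // -tu.
have z_le1 t u : odd t = odd u -> (0 < t <= width k)%N ->
    (0 < u <= width k)%N -> z t <= z u + 1.
  move=> tu t_in u_in; rewrite -(ler_int R) intrD -!cz //.
  by case: (boolP (odd t)) => t_odd;
    [apply: (flat_le_add1 _ _ odd_flat) | apply: (flat_le_add1 _ _ even_flat)];
    apply: (map_f (entry c)); rewrite mem_filter -?tu ?t_odd mem_iota; lia.
have [s z_sum] := mirror_sum_two_values k z hk z_le z_le1.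
pose y i := z i - z (width k - i + 1)%N + 1.
have yc : represents R k s y c.
  move=> i i_in; rewrite !cz; [|lia|lia].
  by have := z_sum i i_in; split; congr _%:~R; rewrite /y; lia.
(* Entries lie between 0 and [height (k - 2) 0 - 1], so a difference plus 1 stays within the
   height. *)
have y_le i : (0 < i <= k - 2)%N -> `|y i| <= height (k - 2) 0.
  move=> i_in; have := z_range i; have := z_range (width k - i + 1)%N.
  by rewrite /y; lia.
have [z01 z_sorted] := orbit_sorted (k - 2) y y_le.
rewrite (_ : 6 * k - 15 = 6 * (k - 2) - 3)%N; last by lia.
exact: represents_flat _ _ _ _ _ hk
  (represents_stages R k hk s y c _ yc) z01 z_sorted.
Qed.
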